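(* Let $\Phi$ be a smooth real-valued function on $\mathbf R^3\setminus\{(0,0,0)\}$ and let $A\neq 0$ be a real number. For each $h\ge 0$, let $(\tau_h,\nu_h)$ be the solution to the initial value problem $$\tau_h'=1+\nu_h\,\Phi(\tau_h,\nu_h,h),\quad \nu_h'=-\tau_h\,\Phi(\tau_h,\nu_h,h),\quad \tau_h(0)=0,\quad \nu_h(0)=A,$$ and assume that $(\tau_0,\nu_0)$ is the constant solution $(0,A)$. Fix $\theta_0\in\mathbf R$ and let $X_h$ be the curve corresponding to $(\tau_h,\nu_h)$ for this choice of $\theta_0$. Then, as $h\to0$, $X_h$ converges to the circle $s\mapsto iAe^{-i\frac sA+i\theta_0}$, $C^k$-uniformly on compact subsets of $\mathbf R$ for each $k$.
   Context: Identify $\mathbf R^2$ with $\mathbf C$. The curve corresponding to $(\tau_h,\nu_h)$ with angle $\theta_0$ is $X_h(s)=(\tau_h(s)+i\nu_h(s))e^{i\theta_h(s)}$, where $\theta_h(s)=\theta_0+\int_0^s\Phi(\tau_h(t),\nu_h(t),h)\,dt$. It is the arc length parametrized plane curve with curvature $k_h=\Phi(\tau_h,\nu_h,h)$, $\tau_h=\langle X_h,T_h\rangle$, $\nu_h=\langle X_h,iT_h\rangle$, where $T_h=X_h'=e^{i\theta_h}$. *)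

(* Defs.v *)
(* Classical real analysis over Stdlib's R with Coquelicot; the plane is
   Coquelicot's C, and a point of R^3 is written (x, y, z) : R * R * R. *)
From Stdlib Require Import Reals.
From Coquelicot Require Import Coquelicot.
Open Scope R_scope.

Definition partial1 (f : R * R * R -> R) (p : R * R * R) : R :=
  let '(x, y, z) := p in Derive (fun t => f (t, y, z)) x.
Definition partial2 (f : R * R * R -> R) (p : R * R * R) : R :=
  let '(x, y, z) := p in Derive (fun t => f (x, t, z)) y.
Definition partial3 (f : R * R * R -> R) (p : R * R * R) : R :=
  let '(x, y, z) := p in Derive (fun t => f (x, y, t)) z.

Definition ex_partials (f : R * R * R -> R) (p : R * R * R) : Prop :=
  let '(x, y, z) := p in
  ex_derive (fun t => f (t, y, z)) x /\
  ex_derive (fun t => f (x, t, z)) y /\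
  ex_derive (fun t => f (x, y, t)) z.

(* Meant for open U: the partial derivatives at a point of U then only involve
   the values of f on U. *)
Fixpoint Ck_on (k : nat) (U : R * R * R -> Prop) (f : R * R * R -> R) : Prop :=
  (forall p, U p -> continuous f p) /\
  match k with
  | O => True
  | S k' =>
      (forall p, U p -> ex_partials f p) /\
      Ck_on k' U (partial1 f) /\ Ck_on k' U (partial2 f) /\
      Ck_on k' U (partial3 f)
  end.

Definition smooth_on (U : R * R * R -> Prop) (f : R * R * R -> R) : Prop :=
  forall k, Ck_on k U f.

Definition Cexp (z : C) : C :=
  (exp (Re z) * cos (Im z), exp (Re z) * sin (Im z)).

Definition angle (Phi : R * R * R -> R) (theta0 : R) (tau nu : R -> R) (h s : R)
    : R :=
  theta0 + RInt (fun t => Phi (tau t, nu t, h)) 0 s.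

Definition curve (Phi : R * R * R -> R) (theta0 : R) (tau nu : R -> R) (h s : R)
    : C :=
  ((RtoC (tau s) + Ci * RtoC (nu s))
     * Cexp (Ci * RtoC (angle Phi theta0 tau nu h s)))%C.

Definition curve_derive_n (X : R -> C) (j : nat) (s : R) : C :=
  (Derive_n (fun t => Re (X t)) j s, Derive_n (fun t => Im (X t)) j s).

Definition curve_Ck (k : nat) (X : R -> C) : Prop :=
  forall (j : nat) (s : R), (j <= k)%nat ->
    ex_derive_n (fun t => Re (X t)) j s /\
    ex_derive_n (fun t => Im (X t)) j s /\
    continuous (curve_derive_n X j) s.

(* The parameter h ranges over [0, +oo), so the limit h -> 0 is taken along the
   trace on [0, +oo) of the neighbourhoods of 0. *)
Definition Ck_converges_on_compacts (k : nat) (X : R -> R -> C) (Y : R -> C)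
    : Prop :=
  (forall h, 0 <= h -> curve_Ck k (X h)) /\
  curve_Ck k Y /\
  forall K : R -> Prop, compact K ->
  forall eps : R, 0 < eps ->
    within (fun h => 0 <= h) (locally 0) (fun h =>
      forall (j : nat) (s : R), (j <= k)%nat -> K s ->
        Cmod (curve_derive_n (X h) j s - curve_derive_n Y j s)%C < eps).

(* Main.v *)
Require Import Defs.
From Stdlib Require Import Reals Lra Lia FunctionalExtensionality.
From Coquelicot Require Import Coquelicot.
Open Scope R_scope.

(** The circle is the curve of the parameter [0] itself, since constancy of
    [(0, A)] forces [1 + A * Phi (0, A, 0) = 0]; so the claim is continuity of
    the family at [h = 0].

    For the state this is a stability estimate with a short energy identity:
    along the flow [E = tau^2 + (nu - A)^2] has [E 0 = 0] and
    [E' = 2 * tau * (1 + A * Phi)], where the last factor vanishes at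
    [(0, A, 0)].  As [Phi] is Lipschitz near that point, this gives
    [|E'| <= c * (E + h^2)] as long as [E] stays below some fixed level, and
    Gronwall's inequality then keeps [E] below any prescribed level on a given
    compact time interval, in both time directions, once [h] is small
    ([gronwall_trap], [state_converges]).  Integrating the curvature transfers
    the convergence to the angle [theta] ([angle_converges]).

    Derivatives of the curve need no further estimate.  The real and imaginary
    parts of [X] have the shape [G1 (p) * cos theta + G2 (p) * sin theta], with
    [p = (tau, nu, h)] and [G1], [G2] smooth off the origin.  Because [p] and
    [theta] solve a differential equation with right-hand sides smooth in [p],
    this shape is preserved by differentiation in arc length, by a rule
    [frame_derive] on the pair [(G1, G2)] that does not involve [h]
    ([frame_Derive_n]).  Hence the derivatives of every order are one fixed
    continuous expression evaluated at [(p, theta)], and they converge because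
    [p] and [theta] do ([frame_eval_converges]). *)

(** * Smooth functions of three variables *)

Lemma triple_ball : forall x y z x' y' z' e : R,
  Rabs (x' - x) < e -> Rabs (y' - y) < e -> Rabs (z' - z) < e ->
  @ball (prod_UniformSpace (prod_UniformSpace R_UniformSpace R_UniformSpace)
           R_UniformSpace) (x, y, z) e (x', y', z').
Proof. intros; repeat split; simpl; assumption. Qed.

Lemma open_slices : forall (U : R * R * R -> Prop) (x y z : R),
  open U -> U (x, y, z) ->
  locally x (fun t => U (t, y, z)) /\
  locally y (fun t => U (x, t, z)) /\
  locally z (fun t => U (x, y, t)).
Proof.
  intros U x y z HU Hp.
  destruct (HU _ Hp) as [e He].
  assert (H0 : forall c : R, Rabs (c - c) < e).
  { intros c; rewrite Rminus_diag, Rabs_R0; apply cond_pos. }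
  repeat split; exists e; intros t Ht; apply He;
    apply triple_ball; auto.
Qed.

Lemma partials_ext : forall (U : R * R * R -> Prop) (f g : R * R * R -> R) p,
  open U -> (forall q, U q -> f q = g q) -> U p ->
  (ex_partials f p -> ex_partials g p) /\
  partial1 f p = partial1 g p /\
  partial2 f p = partial2 g p /\
  partial3 f p = partial3 g p.
Proof.
  intros U f g [[x y] z] HU Hfg Hp.
  destruct (open_slices U x y z HU Hp) as (H1 & H2 & H3).
  split.
  - intros (E1 & E2 & E3); repeat split.
    + eapply ex_derive_ext_loc; [| exact E1].
      revert H1; apply filter_imp; auto.
    + eapply ex_derive_ext_loc; [| exact E2].
      revert H2; apply filter_imp; auto.
    + eapply ex_derive_ext_loc; [| exact E3].
      revert H3; apply filter_imp; auto.
  - repeat split; apply Derive_ext_loc.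
    + revert H1; apply filter_imp; auto.
    + revert H2; apply filter_imp; auto.
    + revert H3; apply filter_imp; auto.
Qed.

(** The partial derivatives of [f] are only known on [U], so the sum and
    product rules identify partial derivatives on [U] alone; this is what lets
    an induction on the order go through such identities. *)
Lemma Ck_on_ext : forall (U : R * R * R -> Prop), open U ->
  forall k f g, (forall q, U q -> f q = g q) -> Ck_on k U f -> Ck_on k U g.
Proof.
  intros U HU k; induction k as [| k IH]; intros f g Hfg [Hc Hd].
  all: assert (Hc' : forall p, U p -> continuous g p) by
    (intros p Hp; apply continuous_ext_loc with f;
       [ destruct (HU p Hp) as [e He]; exists e; auto
       | apply Hc, Hp ]).
  - split; trivial.
  - destruct Hd as (He & H1 & H2 & H3).
    assert (X := fun p => partials_ext U f g p HU Hfg).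
    split; [exact Hc' |].
    split; [intros p Hp; apply (X p Hp), He, Hp |].
    split; [| split].
    + apply IH with (partial1 f); trivial; intros q Hq; apply (X q Hq).
    + apply IH with (partial2 f); trivial; intros q Hq; apply (X q Hq).
    + apply IH with (partial3 f); trivial; intros q Hq; apply (X q Hq).
Qed.

Lemma Ck_on_S : forall U k f, Ck_on (S k) U f -> Ck_on k U f.
Proof.
  intros U k; induction k as [| k IH]; intros f (Hc & He & H1 & H2 & H3).
  - split; trivial.
  - split; [exact Hc |]; auto.
Qed.

Lemma Ck_on_plus : forall (U : R * R * R -> Prop), open U ->
  forall k f g, Ck_on k U f -> Ck_on k U g -> Ck_on k U (fun p => f p + g p).
Proof.
  intros U HU k; induction k as [| k IH]; intros f g [Hc Hd] [Gc Gd];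
    (split; [intros p Hp; apply @continuous_plus; auto |]).
  - trivial.
  - destruct Hd as (He & H1 & H2 & H3), Gd as (Ge & G1 & G2 & G3).
    repeat split.
    + intros [[x y] z] Hp.
      destruct (He _ Hp) as (? & ? & ?), (Ge _ Hp) as (? & ? & ?).
      repeat split; apply @ex_derive_plus; assumption.
    + apply Ck_on_ext with (fun p => partial1 f p + partial1 g p); auto.
      intros [[x y] z] Hp; symmetry; apply Derive_plus;
        [apply (He _ Hp) | apply (Ge _ Hp)].
    + apply Ck_on_ext with (fun p => partial2 f p + partial2 g p); auto.
      intros [[x y] z] Hp; symmetry; apply Derive_plus;
        [apply (He _ Hp) | apply (Ge _ Hp)].
    + apply Ck_on_ext with (fun p => partial3 f p + partial3 g p); auto.
      intros [[x y] z] Hp; symmetry; apply Derive_plus;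
        [apply (He _ Hp) | apply (Ge _ Hp)].
Qed.

Lemma Ck_on_mult : forall (U : R * R * R -> Prop), open U ->
  forall k f g, Ck_on k U f -> Ck_on k U g -> Ck_on k U (fun p => f p * g p).
Proof.
  intros U HU k; induction k as [| k IH]; intros f g Hf Hg;
    (split; [intros p Hp; apply @continuous_mult;
             [apply Hf, Hp | apply Hg, Hp] |]).
  - trivial.
  - pose proof (Ck_on_S _ _ _ Hf) as Hf'.
    pose proof (Ck_on_S _ _ _ Hg) as Hg'.
    destruct Hf as (Hc & He & H1 & H2 & H3), Hg as (Gc & Ge & G1 & G2 & G3).
    repeat split.
    + intros [[x y] z] Hp.
      destruct (He _ Hp) as (? & ? & ?), (Ge _ Hp) as (? & ? & ?).
      repeat split; apply @ex_derive_mult; assumption.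
    + apply Ck_on_ext with (fun p => partial1 f p * g p + f p * partial1 g p).
      * exact HU.
      * intros [[x y] z] Hp; symmetry.
        apply (Derive_mult (fun t => f (t, y, z)) (fun t => g (t, y, z)));
          [apply (He _ Hp) | apply (Ge _ Hp)].
      * apply Ck_on_plus; auto.
    + apply Ck_on_ext with (fun p => partial2 f p * g p + f p * partial2 g p).
      * exact HU.
      * intros [[x y] z] Hp; symmetry.
        apply (Derive_mult (fun t => f (x, t, z)) (fun t => g (x, t, z)));
          [apply (He _ Hp) | apply (Ge _ Hp)].
      * apply Ck_on_plus; auto.
    + apply Ck_on_ext with (fun p => partial3 f p * g p + f p * partial3 g p).
      * exact HU.
      * intros [[x y] z] Hp; symmetry.
        apply (Derive_mult (fun t => f (x, y, t)) (fun t => g (x, y, t)));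
          [apply (He _ Hp) | apply (Ge _ Hp)].
      * apply Ck_on_plus; auto.
Qed.

Lemma smooth_on_const : forall (U : R * R * R -> Prop) (c : R),
  smooth_on U (fun _ => c).
Proof.
  intros U c k; revert c; induction k as [| k IH]; intros c;
    (split; [intros p _; apply continuous_const |]).
  - trivial.
  - assert (E : (fun _ : R * R * R => 0) = partial1 (fun _ => c) /\
                (fun _ : R * R * R => 0) = partial2 (fun _ => c) /\
                (fun _ : R * R * R => 0) = partial3 (fun _ => c)).
    { repeat split; apply functional_extensionality; intros [[x y] z];
        symmetry; exact (Derive_const c _). }
    destruct E as (<- & <- & <-).
    split; [| auto].
    intros [[x y] z] _; repeat split; apply ex_derive_const.
Qed.

Lemma smooth_on_plus : forall U f g, open U ->
  smooth_on U f -> smooth_on U g -> smooth_on U (fun p => f p + g p).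
Proof. intros U f g HU Hf Hg k; apply Ck_on_plus; auto. Qed.

Lemma smooth_on_mult : forall U f g, open U ->
  smooth_on U f -> smooth_on U g -> smooth_on U (fun p => f p * g p).
Proof. intros U f g HU Hf Hg k; apply Ck_on_mult; auto. Qed.

Lemma smooth_on_opp : forall U f, open U ->
  smooth_on U f -> smooth_on U (fun p => - f p).
Proof.
  intros U f HU Hf k.
  apply Ck_on_ext with (fun p => -1 * f p); [exact HU | intros; ring |].
  apply Ck_on_mult; auto; apply smooth_on_const.
Qed.

Lemma smooth_on_partials : forall U f, smooth_on U f ->
  smooth_on U (partial1 f) /\ smooth_on U (partial2 f).
Proof. intros U f Hf; split; intros k; apply (Hf (S k)). Qed.

(** The coordinate functions have constant partial derivatives, so their
    smoothness takes no induction. *)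
Lemma smooth_on_of_const_partials :
  forall (U : R * R * R -> Prop) (f : R * R * R -> R) (a b c : R),
  (forall p, continuous f p) -> (forall p, ex_partials f p) ->
  (forall p, partial1 f p = a) -> (forall p, partial2 f p = b) ->
  (forall p, partial3 f p = c) -> smooth_on U f.
Proof.
  intros U f a b c Hc He H1 H2 H3 [| k]; (split; [auto |]); [trivial |].
  apply functional_extensionality in H1, H2, H3.
  rewrite H1, H2, H3.
  repeat split; try apply smooth_on_const; auto.
Qed.

Lemma smooth_on_coordinates : forall U : R * R * R -> Prop,
  smooth_on U (fun p => fst (fst p)) /\ smooth_on U (fun p => snd (fst p)).
Proof.
  intros U; split;
    [ apply smooth_on_of_const_partials with 1 0 0
    | apply smooth_on_of_const_partials with 0 1 0 ];
    intros [[x y] z].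
  - apply (continuous_comp fst fst); apply continuous_fst.
  - exact (conj (ex_derive_id x) (conj (ex_derive_const x y) (ex_derive_const x z))).
  - exact (Derive_id x).
  - exact (Derive_const x y).
  - exact (Derive_const x z).
  - apply (continuous_comp fst snd); [apply continuous_fst | apply continuous_snd].
  - exact (conj (ex_derive_const y x) (conj (ex_derive_id y) (ex_derive_const y z))).
  - exact (Derive_const y x).
  - exact (Derive_id y).
  - exact (Derive_const y z).
Qed.

Lemma open_punctured_space : open (fun p : R * R * R => p <> (0, 0, 0)).
Proof.
  intros [[x y] z] Hp.
  destruct (Req_dec x 0) as [-> | Hx];
    [destruct (Req_dec y 0) as [-> | Hy];
       [destruct (Req_dec z 0) as [-> | Hz]; [now contradiction Hp |] |] |].
  - destruct (open_neq 0 z Hz) as [e He]; exists e.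
    intros [[x' y'] z'] [_ B] E; injection E; intros -> _ _; now apply (He 0).
  - destruct (open_neq 0 y Hy) as [e He]; exists e.
    intros [[x' y'] z'] [[_ B] _] E; injection E; intros _ -> _; now apply (He 0).
  - destruct (open_neq 0 x Hx) as [e He]; exists e.
    intros [[x' y'] z'] [[B _] _] E; injection E; intros _ _ ->; now apply (He 0).
Qed.

(** The chain rule in the first two variables at fixed [h]: continuous partial
    derivatives give total differentiability in the plane [z = h]. *)
Lemma is_derive_along_curve : forall (U : R * R * R -> Prop) G (x y : R -> R) h s dx dy,
  open U -> Ck_on 1 U G -> U (x s, y s, h) ->
  is_derive x s dx -> is_derive y s dy ->
  is_derive (fun t => G (x t, y t, h)) s
    (partial1 G (x s, y s, h) * dx + partial2 G (x s, y s, h) * dy).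
Proof.
  intros U G x y h s dx dy HU (_ & He & H1 & H2 & _) Hp Hx Hy.
  apply is_derive_Reals.
  apply (derivable_pt_lim_comp_2d (fun u v => G (u, v, h)));
    try (apply is_derive_Reals; assumption).
  apply filterdiff_differentiable_pt_lim.
  apply (is_derive_filterdiff (fun u v => G (u, v, h)) (x s) (y s)
           (fun u v => partial1 G (u, v, h)) (partial2 G (x s, y s, h))).
  - destruct (HU _ Hp) as [e Hball]; exists e.
    intros [u v] [Bu Bv].
    apply Derive_correct, (He (u, v, h)), Hball, triple_ball; simpl in *; auto.
    rewrite Rminus_diag, Rabs_R0; apply cond_pos.
  - apply Derive_correct, (He _ Hp).
  - destruct H1 as [H1 _]; specialize (H1 _ Hp).
    apply (continuous_comp
             (fun q : R * R => (fst q, snd q, h) : R * R * R) (partial1 G));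
      [| exact H1].
    intros P [e HP]; exists e; intros [u v] [Bu Bv]; apply HP; repeat split;
      [exact Bu | exact Bv | apply ball_center].
Qed.

(** * Mean value and comparison estimates *)

Lemma increment_le : forall (f df : R -> R) (a b L : R),
  (forall t, Rabs (t - a) <= Rabs (b - a) ->
     is_derive f t (df t) /\ Rabs (df t) <= L) ->
  Rabs (f b - f a) <= L * Rabs (b - a).
Proof.
  intros f df a b L H.
  assert (Hin : forall t, Rmin a b <= t <= Rmax a b -> Rabs (t - a) <= Rabs (b - a)).
  { intros t Ht; unfold Rmin, Rmax in Ht; destruct (Rle_dec a b);
      unfold Rabs; repeat destruct Rcase_abs; lra. }
  destruct (MVT_gen f a b df) as (c & Hc & ->).
  - intros t Ht; apply H, Hin; lra.
  - intros t Ht; apply continuity_pt_filterlim.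
    apply (ex_derive_continuous f); exists (df t); apply H, Hin, Ht.
  - rewrite Rabs_mult; apply Rmult_le_compat_r; [apply Rabs_pos |].
    apply H, Hin, Hc.
Qed.

(** The first time at which [f] reaches the level [rho]: the supremum of the
    times up to which [f] has stayed below it. *)
Lemma first_hit : forall (f : R -> R) (rho b : R),
  (forall t, continuous f t) -> 0 <= b -> f 0 < rho -> rho <= f b ->
  exists c, 0 < c <= b /\ rho <= f c /\ forall t, 0 <= t < c -> f t < rho.
Proof.
  intros f rho b Hf Hb H0 Hfb.
  assert (Hloc : forall t, f t < rho ->
            exists e : posreal, forall u, Rabs (u - t) < e -> f u < rho).
  { intros t Ht; apply (Hf t (fun y => y < rho)).
    apply (open_lt rho (f t) Ht). }
  pose (E := fun x => 0 <= x <= b /\ forall t, 0 <= t <= x -> f t < rho).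
  destruct (completeness E) as [c [Hub Hlub]].
  { exists b; intros x [Hx _]; lra. }
  { exists 0; split; [lra |]; intros t Ht; replace t with 0 by lra; exact H0. }
  assert (Hbelow : forall t, 0 <= t < c -> f t < rho).
  { intros t Ht; destruct (Rlt_le_dec (f t) rho) as [| Hge]; trivial.
    exfalso; assert (c <= t); [| lra].
    apply Hlub; intros x [Hx Hxt].
    destruct (Rle_lt_dec x t); trivial.
    specialize (Hxt t); lra. }
  assert (Hc0 : 0 <= c).
  { apply Hub; split; [lra |]; intros t Ht; replace t with 0 by lra; exact H0. }
  assert (Hcb : c <= b) by (apply Hlub; intros x [Hx _]; lra).
  assert (Hfc : rho <= f c).
  { destruct (Rle_lt_dec rho (f c)) as [| Hlt]; trivial.
    exfalso; destruct (Hloc c Hlt) as [e He].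
    pose proof (cond_pos e) as He0.
    assert (Hcb' : c < b) by (destruct Hcb; trivial; subst; lra).
    pose (d := Rmin (e / 2) (b - c)).
    assert (Hd : 0 < d /\ d <= e / 2 /\ d <= b - c).
    { unfold d; split; [apply Rmin_glb_lt; lra |].
      split; [apply Rmin_l | apply Rmin_r]. }
    assert (c + d <= c); [| lra].
    apply Hub; split; [lra |].
    intros t Ht; destruct (Rlt_le_dec t c); [apply Hbelow; lra |].
    apply He; rewrite Rabs_pos_eq; lra. }
  exists c; repeat split; trivial.
  destruct Hc0; trivial; subst; lra.
Qed.

(** Gronwall's inequality for a growth bound known only while [E < rho].  Up to
    the first time [a] at which [E] reaches [rho], the function
    [(E + eta) * exp (- c * t)] does not increase, so
    [E a <= eta * exp (c * a) < rho], a contradiction. *)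
Lemma gronwall_trap : forall (E dE : R -> R) (c eta rho S : R),
  0 <= c -> 0 <= eta -> E 0 = 0 ->
  (forall t, is_derive E t (dE t)) ->
  (forall t, E t < rho -> dE t <= c * (E t + eta)) ->
  eta * exp (c * S) < rho ->
  forall t, 0 <= t <= S -> E t < rho.
Proof.
  intros E dE c eta rho S Hc Heta HE0 HdE Hgrow Hsmall t Ht.
  assert (Hrho : 0 < rho).
  { eapply Rle_lt_trans; [| exact Hsmall].
    apply Rmult_le_pos; [exact Heta | left; apply exp_pos]. }
  destruct (Rlt_le_dec (E t) rho) as [| Hge]; trivial; exfalso.
  destruct (first_hit E rho t) as (a & Ha & Hfa & Hbelow); try lra.
  { intros u; apply (ex_derive_continuous E); exists (dE u); apply HdE. }
  destruct (MVT_cor2 (fun u => (E u + eta) * exp (- c * u))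
              (fun u => (dE u - c * (E u + eta)) * exp (- c * u)) 0 a)
    as (u & Hu & Hu0 & Hua).
  - lra.
  - intros u _; apply is_derive_Reals.
    auto_derive; [exists (dE u); apply HdE |].
    replace (Derive (fun x => E x) u) with (dE u)
      by (symmetry; apply is_derive_unique, HdE).
    ring.
  - assert (Hneg : (dE u - c * (E u + eta)) * exp (- c * u) * (a - 0) <= 0).
    { pose proof (Hgrow u (Hbelow u ltac:(lra))).
      pose proof (exp_pos (- c * u)).
      assert (0 <= (c * (E u + eta) - dE u) * exp (- c * u))
        by (apply Rmult_le_pos; lra).
      assert (0 <= (c * (E u + eta) - dE u) * exp (- c * u) * a)
        by (apply Rmult_le_pos; lra).
      lra. }
    rewrite <- Hu, HE0, Rmult_0_r, exp_0 in Hneg.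
    assert (Hexp : exp (c * a) * exp (- c * a) = 1).
    { rewrite <- exp_plus, <- exp_0; f_equal; ring. }
    assert (Hle : E a + eta <= eta * exp (c * a)).
    { replace (E a + eta) with ((E a + eta) * (exp (c * a) * exp (- c * a)))
        by (rewrite Hexp; ring).
      pose proof (exp_pos (c * a)).
      replace ((E a + eta) * (exp (c * a) * exp (- c * a)))
        with (((E a + eta) * exp (- c * a)) * exp (c * a)) by ring.
      apply Rmult_le_compat_r; lra. }
    assert (eta * exp (c * a) <= eta * exp (c * S)).
    { apply Rmult_le_compat_l; trivial.
      assert (Hle' : c * a <= c * S) by (apply Rmult_le_compat_l; lra).
      destruct Hle' as [Hlt | ->]; [left; apply exp_increasing, Hlt | lra]. }
    lra.
Qed.

(** The partial derivatives are bounded near the point, and the increment is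
    split along the three edges of a box, where the mean value inequality
    applies. *)
Lemma C1_locally_Lipschitz : forall (U : R * R * R -> Prop) f x0 y0 z0,
  open U -> Ck_on 1 U f -> U (x0, y0, z0) ->
  exists L r : R, 0 < L /\ 0 < r /\ forall x y z,
    Rabs (x - x0) < r -> Rabs (y - y0) < r -> Rabs (z - z0) < r ->
    Rabs (f (x, y, z) - f (x0, y0, z0)) <=
    L * (Rabs (x - x0) + Rabs (y - y0) + Rabs (z - z0)).
Proof.
  intros U f x0 y0 z0 HU (_ & He & [C1 _] & [C2 _] & [C3 _]) Hp0.
  set (p0 := (x0, y0, z0)).
  set (L := Rabs (partial1 f p0) + Rabs (partial2 f p0) + Rabs (partial3 f p0) + 1).
  assert (P1 := Rabs_pos (partial1 f p0)).
  assert (P2 := Rabs_pos (partial2 f p0)).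
  assert (P3 := Rabs_pos (partial3 f p0)).
  assert (B : forall g : R * R * R -> R, continuous g p0 ->
            locally p0 (fun q => Rabs (g q) <= Rabs (g p0) + 1)).
  { intros g Hg.
    assert (N : locally p0 (fun q => ball (g p0) 1 (g q)))
      by exact (Hg _ (locally_ball (g p0) (mkposreal 1 Rlt_0_1))).
    revert N; apply filter_imp; intros q Hq.
    change (Rabs (g q - g p0) < 1) in Hq.
    pose proof (Rabs_triang_inv (g q) (g p0)); lra. }
  assert (N := filter_and _ _ (HU _ Hp0)
    (filter_and _ _ (B _ (C1 _ Hp0))
       (filter_and _ _ (B _ (C2 _ Hp0)) (B _ (C3 _ Hp0))))).
  destruct N as [r Hr].
  exists L, r; split; [unfold L; lra |]; split; [apply cond_pos |].
  intros x y z Hx Hy Hz.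
  assert (Hbox : forall u v w, Rabs (u - x0) <= Rabs (x - x0) ->
    Rabs (v - y0) <= Rabs (y - y0) -> Rabs (w - z0) <= Rabs (z - z0) ->
    ex_partials f (u, v, w) /\ Rabs (partial1 f (u, v, w)) <= L /\
    Rabs (partial2 f (u, v, w)) <= L /\ Rabs (partial3 f (u, v, w)) <= L).
  { intros u v w Hu Hv Hw.
    destruct (Hr (u, v, w)) as (V & V1 & V2 & V3).
    { apply triple_ball; lra. }
    split; [apply He, V |]; unfold L; lra. }
  assert (Z : forall c d : R, Rabs (c - c) <= Rabs (d - c)).
  { intros c d; rewrite Rminus_diag, Rabs_R0; apply Rabs_pos. }
  assert (D1 : Rabs (f (x, y, z) - f (x0, y, z)) <= L * Rabs (x - x0)).
  { apply (increment_le (fun t => f (t, y, z)) (fun t => partial1 f (t, y, z))).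
    intros t Ht; destruct (Hbox t y z) as (X & X1 & _ & _);
      try lra; split; [apply Derive_correct, X | exact X1]. }
  assert (D2 : Rabs (f (x0, y, z) - f (x0, y0, z)) <= L * Rabs (y - y0)).
  { apply (increment_le (fun t => f (x0, t, z)) (fun t => partial2 f (x0, t, z))).
    intros t Ht; destruct (Hbox x0 t z) as (X & _ & X2 & _);
      try lra; auto; split; [apply Derive_correct, X | exact X2]. }
  assert (D3 : Rabs (f (x0, y0, z) - f (x0, y0, z0)) <= L * Rabs (z - z0)).
  { apply (increment_le (fun t => f (x0, y0, t)) (fun t => partial3 f (x0, y0, t))).
    intros t Ht; destruct (Hbox x0 y0 t) as (X & _ & _ & X3);
      try lra; auto; split; [apply Derive_correct, X | exact X3]. }
  unfold p0.
  replace (f (x, y, z) - f (x0, y0, z0)) with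
    ((f (x, y, z) - f (x0, y, z)) + (f (x0, y, z) - f (x0, y0, z))
     + (f (x0, y0, z) - f (x0, y0, z0))) by ring.
  eapply Rle_trans; [apply Rabs_triang |].
  pose proof (Rabs_triang (f (x, y, z) - f (x0, y, z))
                (f (x0, y, z) - f (x0, y0, z))).
  lra.
Qed.

(** * The perturbed solutions stay near the constant one *)

Definition solves (Phi : R * R * R -> R) (A : R) (x y : R -> R) (h : R) : Prop :=
  (forall s, is_derive x s (1 + y s * Phi (x s, y s, h)) /\
             is_derive y s (- x s * Phi (x s, y s, h))) /\
  x 0 = 0 /\ y 0 = A.

(** Locally uniform convergence to zero as [h] decreases to [0]; intervals
    centred at [0] suffice because compact sets are bounded. *)
Definition small_on_compacts (e : R -> R -> R) : Prop :=
  forall S eps : R, 0 < eps ->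
    exists d : R, 0 < d /\
      forall h s : R, 0 <= h < d -> Rabs s <= S -> Rabs (e h s) < eps.

Lemma Rabs_lt_of_square : forall a b m : R,
  0 < m -> a * a + b * b < m * m -> Rabs a < m /\ Rabs b < m.
Proof.
  intros a b m Hm H; split; apply Rabs_def1; nra.
Qed.

(** In the derivative of the energy [E = tau^2 + (nu - A)^2] the terms in
    [tau * nu * Phi] cancel and leave [2 * tau * (1 + A * Phi)]; by the
    Lipschitz bound at [(0, A, 0)] this is at most a multiple of [E + h^2].
    Backward times are handled by reflecting [E]. *)
Lemma state_converges : forall (Phi : R * R * R -> R) (A : R) (tau nu : R -> R -> R),
  Ck_on 1 (fun p => p <> (0, 0, 0)) Phi -> A <> 0 -> 1 + A * Phi (0, A, 0) = 0 ->
  (forall h, 0 <= h -> solves Phi A (tau h) (nu h) h) ->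
  small_on_compacts tau /\ small_on_compacts (fun h s => nu h s - A).
Proof.
  intros Phi A tau nu HPhi HA Heq Hsol.
  assert (Hboth : forall S eps, 0 < eps -> exists d, 0 < d /\
            forall h s, 0 <= h < d -> Rabs s <= S ->
            Rabs (tau h s) < eps /\ Rabs (nu h s - A) < eps).
  { intros S eps Heps.
    destruct (C1_locally_Lipschitz _ Phi 0 A 0 open_punctured_space HPhi)
      as (L & r & HL & Hr & HLip).
    { intros E; injection E; intros; contradiction. }
    (* [c] comes from
       [2 a (a + b + h) <= 4 (a^2 + b^2 + h^2)]; [q] is chosen so that
       [h < m * q] means [h^2 * exp (c * S) < m^2]. *)
    set (c := 4 * (Rabs A * L)).
    set (m := Rmin r eps).
    set (q := exp (- (c * S / 2))).
    assert (Hm : 0 < m) by (apply Rmin_glb_lt; assumption).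
    assert (Hmr : m <= r) by apply Rmin_l.
    assert (Hme : m <= eps) by apply Rmin_r.
    assert (Hq : 0 < q) by apply exp_pos.
    assert (Hc : 0 <= c).
    { unfold c; pose proof (Rabs_pos A).
      assert (0 <= Rabs A * L) by (apply Rmult_le_pos; lra); lra. }
    assert (Hqq : q * q * exp (c * S) = 1).
    { unfold q; rewrite <- !exp_plus, <- exp_0; f_equal; field. }
    exists (Rmin r (m * q)).
    split; [apply Rmin_glb_lt; [| apply Rmult_lt_0_compat]; assumption |].
    intros h s [Hh0 Hhd] Hs.
    assert (Hhr : h < r) by (eapply Rlt_le_trans; [exact Hhd | apply Rmin_l]).
    assert (Hhq : h < m * q) by (eapply Rlt_le_trans; [exact Hhd | apply Rmin_r]).
    clear Hhd.
    destruct (Hsol h Hh0) as (Hode & H0t & H0n).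
    set (E := fun t => tau h t * tau h t + (nu h t - A) * (nu h t - A)).
    set (dE := fun t => 2 * tau h t * (1 + A * Phi (tau h t, nu h t, h))).
    assert (HE0 : E 0 = 0) by (unfold E; rewrite H0t, H0n; ring).
    assert (HdE : forall t, is_derive E t (dE t)).
    { intros t; destruct (Hode t) as [Ht Hn]; unfold E, dE.
      auto_derive.
      - repeat split; eexists; eassumption.
      - replace (Derive (fun x => tau h x) t)
          with (1 + nu h t * Phi (tau h t, nu h t, h))
          by (symmetry; apply is_derive_unique, Ht).
        replace (Derive (fun x => nu h x) t)
          with (- tau h t * Phi (tau h t, nu h t, h))
          by (symmetry; apply is_derive_unique, Hn).
        ring. }
    assert (Hgrow : forall t, E t < m * m -> Rabs (dE t) <= c * (E t + h * h)).
    { intros t Ht.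
      destruct (Rabs_lt_of_square _ _ _ Hm Ht) as [Bt Bn].
      assert (Lip : Rabs (Phi (tau h t, nu h t, h) - Phi (0, A, 0)) <=
                    L * (Rabs (tau h t) + Rabs (nu h t - A) + h)).
      { generalize (HLip (tau h t) (nu h t) h).
        rewrite !Rminus_0_r, (Rabs_pos_eq h) by assumption.
        intros X; apply X; lra. }
      unfold dE.
      replace (1 + A * Phi (tau h t, nu h t, h))
        with (A * (Phi (tau h t, nu h t, h) - Phi (0, A, 0)))
        by (rewrite Rmult_minus_distr_l; lra).
      rewrite !Rabs_mult, (Rabs_pos_eq 2) by lra.
      unfold E, c.
      replace (tau h t * tau h t) with (Rabs (tau h t) * Rabs (tau h t))
        by (symmetry; apply Rsqr_abs).
      replace ((nu h t - A) * (nu h t - A))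
        with (Rabs (nu h t - A) * Rabs (nu h t - A)) by (symmetry; apply Rsqr_abs).
      set (a := Rabs (tau h t)) in *.
      set (b := Rabs (nu h t - A)) in *.
      assert (Ha : 0 <= a) by apply Rabs_pos.
      assert (HA0 : 0 <= Rabs A) by apply Rabs_pos.
      apply Rle_trans with (2 * a * (Rabs A * (L * (a + b + h)))).
      - apply Rmult_le_compat_l; [lra |]; apply Rmult_le_compat_l; assumption.
      - replace (2 * a * (Rabs A * (L * (a + b + h))))
          with (Rabs A * L * (2 * a * (a + b + h))) by ring.
        replace (4 * (Rabs A * L) * (a * a + b * b + h * h))
          with (Rabs A * L * (4 * (a * a + b * b + h * h))) by ring.
        apply Rmult_le_compat_l; [apply Rmult_le_pos; lra |].
        pose proof (Rle_0_sqr (a - b)); pose proof (Rle_0_sqr (a - h)).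
        pose proof (Rle_0_sqr b); pose proof (Rle_0_sqr h); unfold Rsqr in *; lra. }
    assert (Hsmall : h * h * exp (c * S) < m * m).
    { replace (m * m) with (m * q * (m * q) * exp (c * S))
        by (transitivity (m * m * (q * q * exp (c * S))); [| rewrite Hqq]; ring).
      apply Rmult_lt_compat_r; [apply exp_pos |].
      apply Rmult_le_0_lt_compat; lra. }
    assert (Hhh : 0 <= h * h) by (apply Rmult_le_pos; assumption).
    assert (HEs : E s < m * m).
    { destruct (Rle_lt_dec 0 s) as [Hs0 | Hs0].
      - apply (gronwall_trap E dE c (h * h) (m * m) S); trivial.
        + intros t Ht; pose proof (Hgrow t Ht); pose proof (Rle_abs (dE t)); lra.
        + rewrite Rabs_pos_eq in Hs; lra.
      - replace s with (- - s) by ring.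
        apply (gronwall_trap (fun t => E (- t)) (fun t => - dE (- t)) c (h * h)
                 (m * m) S); trivial.
        + rewrite Ropp_0; exact HE0.
        + intros t.
          replace (- dE (- t)) with (scal (-1) (dE (- t)))
            by (unfold scal; simpl; unfold mult; simpl; ring).
          apply (is_derive_comp E (fun t => - t)); [apply HdE |].
          auto_derive; trivial.
        + intros t Ht; pose proof (Hgrow (- t) Ht).
          pose proof (Rle_abs (- dE (- t))).
          rewrite Rabs_Ropp in *; lra.
        + rewrite Rabs_left in Hs; lra. }
    destruct (Rabs_lt_of_square _ _ _ Hm HEs); lra. }
  split; intros S eps Heps; destruct (Hboth S eps Heps) as (d & Hd & H);
    exists d; split; trivial; intros h s Hh Hs; apply (H h s Hh Hs).
Qed.

Lemma observable_converges : forall (tau nu : R -> R -> R) (A : R) G,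
  small_on_compacts tau -> small_on_compacts (fun h s => nu h s - A) ->
  continuous G (0, A, 0) ->
  small_on_compacts (fun h s => G (tau h s, nu h s, h) - G (0, A, 0)).
Proof.
  intros tau nu A G Ht Hn HG S eps Heps.
  destruct (HG _ (locally_ball (G (0, A, 0)) (mkposreal eps Heps))) as [r Hr].
  destruct (Ht S r (cond_pos r)) as (d1 & Hd1 & H1).
  destruct (Hn S r (cond_pos r)) as (d2 & Hd2 & H2).
  exists (Rmin r (Rmin d1 d2)); split.
  { repeat apply Rmin_glb_lt; trivial; apply cond_pos. }
  intros h s [Hh0 Hh] Hs.
  assert (h < r /\ h < d1 /\ h < d2) as (Hhr & Hhd1 & Hhd2).
  { pose proof (Rmin_l r (Rmin d1 d2)); pose proof (Rmin_r r (Rmin d1 d2)).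
    pose proof (Rmin_l d1 d2); pose proof (Rmin_r d1 d2); lra. }
  apply (Hr (tau h s, nu h s, h)), triple_ball.
  - rewrite Rminus_0_r; apply H1; lra.
  - apply H2; lra.
  - rewrite Rminus_0_r, Rabs_pos_eq; lra.
Qed.

Lemma is_derive_angle : forall Phi theta0 (x y : R -> R) h,
  (forall t, continuous (fun t => Phi (x t, y t, h)) t) ->
  forall s, is_derive (angle Phi theta0 x y h) s (Phi (x s, y s, h)).
Proof.
  intros Phi theta0 x y h Hc s; unfold angle.
  replace (Phi (x s, y s, h)) with (plus 0 (Phi (x s, y s, h)))
    by (unfold plus; simpl; ring).
  apply (is_derive_plus (fun _ => theta0)).
  - apply @is_derive_const.
  - apply (is_derive_RInt (fun t => Phi (x t, y t, h)) _ 0); [| apply Hc].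
    apply filter_forall; intros b.
    apply (RInt_correct (V := R_CompleteNormedModule)).
    apply (ex_RInt_continuous (V := R_CompleteNormedModule)); auto.
Qed.

Lemma angle_converges : forall Phi theta0 (tau nu theta : R -> R -> R) A,
  (forall h, 0 <= h -> forall s,
     is_derive (theta h) s (Phi (tau h s, nu h s, h))) ->
  (forall h, theta h 0 = theta0) ->
  (forall s, tau 0 s = 0 /\ nu 0 s = A) ->
  small_on_compacts (fun h s => Phi (tau h s, nu h s, h) - Phi (0, A, 0)) ->
  small_on_compacts (fun h s => theta h s - theta 0 s).
Proof.
  intros Phi theta0 tau nu theta A Hth E0 H0 Hsmall S eps Heps.
  set (M := Rmax S 0 + 1).
  assert (HM : 0 < M) by (unfold M; pose proof (Rmax_r S 0); lra).
  assert (HSM : S < M) by (unfold M; pose proof (Rmax_l S 0); lra).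
  destruct (Hsmall S (eps / (2 * M))) as (d & Hd & B);
    [apply Rdiv_lt_0_compat; lra |].
  exists d; split; trivial; intros h s Hh Hs.
  assert (Hinc : Rabs ((theta h s - theta 0 s) - (theta h 0 - theta 0 0))
                 <= eps / (2 * M) * Rabs (s - 0)).
  { apply (increment_le (fun t => theta h t - theta 0 t)
             (fun t => Phi (tau h t, nu h t, h) - Phi (0, A, 0))).
    intros t Ht; rewrite !Rminus_0_r in Ht; split.
    - apply (is_derive_minus (theta h) (theta 0)); [apply Hth; lra |].
      destruct (H0 t) as [E1 E2].
      pose proof (Hth 0 (Rle_refl 0) t) as D; rewrite E1, E2 in D; exact D.
    - left; apply B; lra. }
  rewrite !E0, Rminus_diag, !Rminus_0_r in Hinc.
  eapply Rle_lt_trans; [exact Hinc |].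
  apply Rle_lt_trans with (eps / (2 * M) * M).
  - apply Rmult_le_compat_l; [left; apply Rdiv_lt_0_compat; lra | lra].
  - replace (eps / (2 * M) * M) with (eps / 2) by (field; lra); lra.
Qed.

(** * Expressions in the rotating frame *)

(** The real part of [(G1 - i G2) (p) * exp (i theta)]: a component, in fixed
    axes, of a vector whose coordinates in the moving frame are functions of
    the state. *)
Definition frame_eval (F : (R * R * R -> R) * (R * R * R -> R)) p (theta : R) : R :=
  fst F p * cos theta + snd F p * sin theta.

(** The Lie derivative of [G] along the vector field of the system. *)
Definition flow_derive (Phi G : R * R * R -> R) (p : R * R * R) : R :=
  partial1 G p * (1 + snd (fst p) * Phi p) + partial2 G p * (- fst (fst p) * Phi p).

(** The terms without [flow_derive] come from differentiating [cos theta] and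
    [sin theta], where [theta' = Phi]. *)
Definition frame_derive (Phi : R * R * R -> R)
    (F : (R * R * R -> R) * (R * R * R -> R)) :=
  (fun p => flow_derive Phi (fst F) p + snd F p * Phi p,
   fun p => flow_derive Phi (snd F) p + - (fst F p * Phi p)).

Definition smooth_frame U (F : (R * R * R -> R) * (R * R * R -> R)) : Prop :=
  smooth_on U (fst F) /\ smooth_on U (snd F).

Lemma smooth_flow_derive : forall U Phi G, open U ->
  smooth_on U Phi -> smooth_on U G -> smooth_on U (flow_derive Phi G).
Proof.
  intros U Phi G HU HPhi HG.
  destruct (smooth_on_coordinates U), (smooth_on_partials U G HG).
  apply smooth_on_plus; [exact HU | |]; apply smooth_on_mult; trivial.
  - apply smooth_on_plus; [exact HU | apply smooth_on_const |].
    apply smooth_on_mult; trivial.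
  - apply smooth_on_mult; trivial; apply smooth_on_opp; trivial.
Qed.

Lemma smooth_frame_iter : forall U Phi F, open U ->
  smooth_on U Phi -> smooth_frame U F ->
  forall j, smooth_frame U (Nat.iter j (frame_derive Phi) F).
Proof.
  intros U Phi F HU HPhi HF j; induction j as [| j [IH1 IH2]]; [exact HF |].
  split; simpl; (apply smooth_on_plus;
    [exact HU | apply smooth_flow_derive; assumption |]).
  - apply smooth_on_mult; assumption.
  - apply smooth_on_opp; [| apply smooth_on_mult]; assumption.
Qed.

Lemma is_derive_frame : forall U Phi F A x y h (theta : R -> R),
  open U -> smooth_frame U F -> (forall s, U (x s, y s, h)) ->
  solves Phi A x y h -> (forall s, is_derive theta s (Phi (x s, y s, h))) ->
  forall s, is_derive (fun t => frame_eval F (x t, y t, h) (theta t)) s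
              (frame_eval (frame_derive Phi F) (x s, y s, h) (theta s)).
Proof.
  intros U Phi F A x y h theta HU [F1 F2] Hin [Hode _] Hth s.
  destruct (Hode s) as [Hx Hy].
  pose proof (is_derive_along_curve U (fst F) x y h s _ _ HU (F1 1%nat) (Hin s) Hx Hy)
    as D1.
  pose proof (is_derive_along_curve U (snd F) x y h s _ _ HU (F2 1%nat) (Hin s) Hx Hy)
    as D2.
  specialize (Hth s).
  set (f1 := fun t => fst F (x t, y t, h)) in D1.
  set (f2 := fun t => snd F (x t, y t, h)) in D2.
  change (is_derive (fun t => f1 t * cos (theta t) + f2 t * sin (theta t)) s
            (frame_eval (frame_derive Phi F) (x s, y s, h) (theta s))).
  auto_derive.
  - repeat split; eexists; eassumption.
  - replace (Derive (fun t => f1 t) s) with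
      (partial1 (fst F) (x s, y s, h) * (1 + y s * Phi (x s, y s, h)) +
       partial2 (fst F) (x s, y s, h) * (- x s * Phi (x s, y s, h)))
      by (symmetry; apply is_derive_unique, D1).
    replace (Derive (fun t => f2 t) s) with
      (partial1 (snd F) (x s, y s, h) * (1 + y s * Phi (x s, y s, h)) +
       partial2 (snd F) (x s, y s, h) * (- x s * Phi (x s, y s, h)))
      by (symmetry; apply is_derive_unique, D2).
    replace (Derive (fun t => theta t) s) with (Phi (x s, y s, h))
      by (symmetry; apply is_derive_unique, Hth).
    unfold frame_eval, frame_derive, flow_derive, f1, f2; cbn [fst snd]; ring.
Qed.

(** The [j]-th derivative is read off from a pair of coefficient functions that
    is the same for all solutions and all [h]. *)
Lemma frame_Derive_n : forall U Phi F A x y h (theta : R -> R),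
  open U -> smooth_on U Phi -> smooth_frame U F -> (forall s, U (x s, y s, h)) ->
  solves Phi A x y h -> (forall s, is_derive theta s (Phi (x s, y s, h))) ->
  forall f : R -> R, (forall t, f t = frame_eval F (x t, y t, h) (theta t)) ->
  forall j s,
    Derive_n f j s =
      frame_eval (Nat.iter j (frame_derive Phi) F) (x s, y s, h) (theta s) /\
    ex_derive (Derive_n f j) s.
Proof.
  intros U Phi F A x y h theta HU HPhi HF Hin Hsol Hth f Hf j.
  pose proof (fun i => is_derive_frame U Phi _ A x y h theta HU
    (smooth_frame_iter U Phi F HU HPhi HF i) Hin Hsol Hth) as D.
  assert (Hj : forall s, Derive_n f j s =
            frame_eval (Nat.iter j (frame_derive Phi) F) (x s, y s, h) (theta s)).
  { induction j as [| j IH]; intros s; [apply Hf |].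
    simpl; rewrite (Derive_ext _ _ s IH); apply is_derive_unique, (D j). }
  intros s; split; [apply Hj |].
  eapply ex_derive_ext; [intros t; symmetry; apply Hj |].
  eexists; apply D.
Qed.

Lemma cos_sin_increment : forall a b,
  Rabs (cos b - cos a) <= Rabs (b - a) /\ Rabs (sin b - sin a) <= Rabs (b - a).
Proof.
  intros a b; rewrite <- (Rmult_1_l (Rabs (b - a))); split.
  - apply increment_le with (fun t => - sin t); intros t _; split.
    + apply is_derive_Reals, derivable_pt_lim_cos.
    + rewrite Rabs_Ropp; apply Rabs_le, SIN_bound.
  - apply increment_le with cos; intros t _; split.
    + apply is_derive_Reals, derivable_pt_lim_sin.
    + apply Rabs_le, COS_bound.
Qed.

(** The coefficients converge to constants, hence stay bounded, and [cos] and
    [sin] are 1-Lipschitz in the angle. *)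
Lemma frame_eval_converges : forall (tau nu theta : R -> R -> R) (A : R) F,
  small_on_compacts (fun h s => fst F (tau h s, nu h s, h) - fst F (0, A, 0)) ->
  small_on_compacts (fun h s => snd F (tau h s, nu h s, h) - snd F (0, A, 0)) ->
  small_on_compacts (fun h s => theta h s - theta 0 s) ->
  small_on_compacts (fun h s => frame_eval F (tau h s, nu h s, h) (theta h s)
                                - frame_eval F (0, A, 0) (theta 0 s)).
Proof.
  intros tau nu theta A F H1 H2 Hth S eps Heps.
  set (M := Rabs (fst F (0, A, 0)) + Rabs (snd F (0, A, 0)) + 1).
  pose proof (Rabs_pos (fst F (0, A, 0))) as P1.
  pose proof (Rabs_pos (snd F (0, A, 0))) as P2.
  assert (HM : 0 < M) by (unfold M; lra).
  destruct (H1 S (eps / 4)) as (d1 & Hd1 & B1); [lra |].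
  destruct (H2 S (eps / 4)) as (d2 & Hd2 & B2); [lra |].
  destruct (Hth S (eps / (4 * M))) as (d3 & Hd3 & B3).
  { apply Rdiv_lt_0_compat; lra. }
  exists (Rmin d1 (Rmin d2 d3)); split.
  { repeat apply Rmin_glb_lt; trivial. }
  intros h s [Hh0 Hh] Hs.
  assert (h < d1 /\ h < d2 /\ h < d3) as (L1 & L2 & L3).
  { pose proof (Rmin_l d1 (Rmin d2 d3)); pose proof (Rmin_r d1 (Rmin d2 d3)).
    pose proof (Rmin_l d2 d3); pose proof (Rmin_r d2 d3); lra. }
  specialize (B1 h s (conj Hh0 L1) Hs); specialize (B2 h s (conj Hh0 L2) Hs).
  specialize (B3 h s (conj Hh0 L3) Hs).
  destruct (cos_sin_increment (theta 0 s) (theta h s)) as [Bc Bs].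
  unfold frame_eval.
  set (u := fst F (tau h s, nu h s, h)) in *; set (u0 := fst F (0, A, 0)) in *.
  set (v := snd F (tau h s, nu h s, h)) in *; set (v0 := snd F (0, A, 0)) in *.
  set (a := theta h s) in *; set (b := theta 0 s) in *.
  replace (u * cos a + v * sin a - (u0 * cos b + v0 * sin b)) with
    (((u - u0) * cos a + (v - v0) * sin a)
     + (u0 * (cos a - cos b) + v0 * (sin a - sin b))) by ring.
  assert (Ca : Rabs (cos a) <= 1) by (apply Rabs_le, COS_bound).
  assert (Sa : Rabs (sin a) <= 1) by (apply Rabs_le, SIN_bound).
  assert (T1 : Rabs ((u - u0) * cos a) <= Rabs (u - u0)).
  { rewrite Rabs_mult; rewrite <- (Rmult_1_r (Rabs (u - u0))) at 2.
    apply Rmult_le_compat_l; [apply Rabs_pos | assumption]. }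
  assert (T2 : Rabs ((v - v0) * sin a) <= Rabs (v - v0)).
  { rewrite Rabs_mult; rewrite <- (Rmult_1_r (Rabs (v - v0))) at 2.
    apply Rmult_le_compat_l; [apply Rabs_pos | assumption]. }
  assert (T3 : Rabs (u0 * (cos a - cos b)) <= Rabs u0 * Rabs (a - b)).
  { rewrite Rabs_mult; apply Rmult_le_compat_l; assumption. }
  assert (T4 : Rabs (v0 * (sin a - sin b)) <= Rabs v0 * Rabs (a - b)).
  { rewrite Rabs_mult; apply Rmult_le_compat_l; assumption. }
  assert (T5 : (Rabs u0 + Rabs v0) * Rabs (a - b) <= eps / 4).
  { apply Rle_trans with (M * (eps / (4 * M))); [| right; field; lra].
    apply Rmult_le_compat; [lra | apply Rabs_pos | unfold M; lra | lra]. }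
  pose proof (Rabs_triang ((u - u0) * cos a + (v - v0) * sin a)
                (u0 * (cos a - cos b) + v0 * (sin a - sin b))).
  pose proof (Rabs_triang ((u - u0) * cos a) ((v - v0) * sin a)).
  pose proof (Rabs_triang (u0 * (cos a - cos b)) (v0 * (sin a - sin b))).
  lra.
Qed.

Lemma small_on_compacts_finite : forall e : nat -> R -> R -> R,
  (forall j, small_on_compacts (e j)) ->
  forall (k : nat) (S eps : R), 0 < eps ->
    exists d, 0 < d /\ forall h s j, 0 <= h < d -> Rabs s <= S -> (j <= k)%nat ->
      Rabs (e j h s) < eps.
Proof.
  intros e He k S eps Heps; induction k as [| k (d & Hd & IH)].
  - destruct (He 0%nat S eps Heps) as (d & Hd & H); exists d; split; trivial.
    intros h s j Hh Hs Hj; replace j with 0%nat by lia; auto.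
  - destruct (He (Datatypes.S k) S eps Heps) as (d' & Hd' & H).
    exists (Rmin d d'); split; [apply Rmin_glb_lt; trivial |].
    intros h s j Hh Hs Hj.
    pose proof (Rmin_l d d'); pose proof (Rmin_r d d').
    destruct (Nat.eq_dec j (Datatypes.S k)) as [-> |].
    + apply H; trivial; lra.
    + apply IH; trivial; [lra | lia].
Qed.

(** * The curves *)

Definition frame_re : (R * R * R -> R) * (R * R * R -> R) :=
  (fun p => fst (fst p), fun p => - snd (fst p)).

Definition frame_im : (R * R * R -> R) * (R * R * R -> R) :=
  (fun p => snd (fst p), fun p => fst (fst p)).

Lemma curve_components : forall Phi theta0 (x y : R -> R) h s,
  curve Phi theta0 x y h s =
  (frame_eval frame_re (x s, y s, h) (angle Phi theta0 x y h s),
   frame_eval frame_im (x s, y s, h) (angle Phi theta0 x y h s)).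
Proof.
  intros Phi theta0 x y h s; unfold curve, Cexp.
  generalize (angle Phi theta0 x y h s); intros th.
  replace (Im (Ci * RtoC th)%C) with th by (simpl; ring).
  replace (Re (Ci * RtoC th)%C) with 0 by (simpl; ring).
  rewrite exp_0.
  unfold frame_eval, frame_re, frame_im.
  apply injective_projections; simpl; ring.
Qed.

(** At the constant state the curvature is [- / A], so the angle at [s] is
    [theta0 - s / A]. *)
Lemma circle_is_curve : forall Phi A theta0 (x y : R -> R),
  A <> 0 -> 1 + A * Phi (0, A, 0) = 0 -> (forall s, x s = 0 /\ y s = A) ->
  (fun s => (Ci * RtoC A * Cexp (- Ci * RtoC (s / A) + Ci * RtoC theta0))%C)
  = curve Phi theta0 x y 0.
Proof.
  intros Phi A theta0 x y HA Heq Hxy; apply functional_extensionality; intros s.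
  rewrite curve_components.
  assert (Hang : angle Phi theta0 x y 0 s = theta0 - s / A).
  { unfold angle.
    rewrite (RInt_ext _ (fun _ => - / A)).
    - rewrite RInt_const; unfold scal; simpl; unfold mult; simpl; field; exact HA.
    - intros t _; destruct (Hxy t) as [-> ->].
      apply (Rmult_eq_reg_l A); trivial.
      replace (A * - / A) with (-1) by (field; exact HA); lra. }
  rewrite Hang; unfold Cexp.
  set (w := (- Ci * RtoC (s / A) + Ci * RtoC theta0)%C).
  replace (Im w) with (theta0 - s / A) by (unfold w; simpl; ring).
  replace (Re w) with 0 by (unfold w; simpl; ring).
  destruct (Hxy s) as [-> ->].
  rewrite exp_0; unfold frame_eval, frame_re, frame_im.
  apply injective_projections; simpl; ring.
Qed.

Lemma continuous_C : forall (f g : R -> R) (s : R),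
  continuous f s -> continuous g s ->
  continuous (fun t => (f t, g t) : C) s.
Proof.
  intros f g s Hf Hg P [e HP].
  assert (Nf : locally s (fun t => ball (f s) e (f t)))
    by exact (Hf _ (locally_ball (f s) e)).
  assert (Ng : locally s (fun t => ball (g s) e (g t)))
    by exact (Hg _ (locally_ball (g s) e)).
  destruct (filter_and _ _ Nf Ng) as [d Hd]; exists d; intros t Ht.
  destruct (Hd t Ht) as [H1 H2]; apply HP; split; assumption.
Qed.

Lemma Cmod_minus_le : forall a b c d : R,
  Cmod ((a, b) - (c, d))%C <= Rabs (a - c) + Rabs (b - d).
Proof.
  intros a b c d.
  replace ((a, b) - (c, d))%C with (RtoC (a - c) + Ci * RtoC (b - d))%C
    by (apply injective_projections; simpl; ring).
  eapply Rle_trans; [apply Cmod_triangle |].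
  rewrite Cmod_mult, !Cmod_R.
  replace (Cmod Ci) with 1; [lra |].
  unfold Cmod; simpl; rewrite <- sqrt_1 at 1; f_equal; ring.
Qed.

Theorem corollary4p12 :
  forall (Phi : R * R * R -> R) (A : R) (tau nu : R -> R -> R) (theta0 : R),
    smooth_on (fun p => p <> (0, 0, 0)) Phi ->
    A <> 0 ->
    (forall h : R, 0 <= h ->
       (forall s : R,
          is_derive (tau h) s (1 + nu h s * Phi (tau h s, nu h s, h)) /\
          is_derive (nu h) s (- tau h s * Phi (tau h s, nu h s, h))) /\
       tau h 0 = 0 /\ nu h 0 = A) ->
    (forall s : R, tau 0 s = 0 /\ nu 0 s = A) ->
    forall k : nat,
      Ck_converges_on_compacts k
        (fun h => curve Phi theta0 (tau h) (nu h) h)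
        (fun s => (Ci * RtoC A * Cexp (- Ci * RtoC (s / A) + Ci * RtoC theta0))%C).
Proof.
  intros Phi A tau nu theta0 HPhi HA Hsol H0 k.
  set (U := fun p : R * R * R => p <> (0, 0, 0)) in HPhi.
  assert (HU : open U) by apply open_punctured_space.
  assert (Hp0 : U (0, A, 0)) by (intros E; injection E; intros; contradiction).
  assert (Heq : 1 + A * Phi (0, A, 0) = 0).
  { destruct (Hsol 0 (Rle_refl 0)) as [Hode _].
    destruct (Hode 0) as [Ht _]; destruct (H0 0) as [E1 E2].
    rewrite E1, E2 in Ht.
    rewrite <- (is_derive_unique _ _ _ Ht).
    rewrite (Derive_ext _ (fun _ => 0)) by (intros t; apply H0).
    apply Derive_const. }
  assert (Hin : forall h, 0 <= h -> forall s, U (tau h s, nu h s, h)).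
  { intros h [Hh | <-] s E.
    - injection E; intros; lra.
    - destruct (H0 s) as [E1 E2]; rewrite E1, E2 in E; exact (Hp0 E). }
  set (theta := fun h s => angle Phi theta0 (tau h) (nu h) h s).
  assert (Hth : forall h, 0 <= h -> forall s,
            is_derive (theta h) s (Phi (tau h s, nu h s, h))).
  { intros h Hh; apply (is_derive_angle Phi theta0 (tau h) (nu h) h); intros t.
    destruct (Hsol h Hh) as [Hode _]; destruct (Hode t) as [Dt Dn].
    apply (ex_derive_continuous (fun t => Phi (tau h t, nu h t, h))).
    eexists; apply (is_derive_along_curve U Phi); eauto. }
  (* The limit is now the member [h = 0] of the family, so its regularity and
     its derivatives are covered by the statements about the family. *)
  rewrite (circle_is_curve Phi A theta0 (tau 0) (nu 0) HA Heq H0).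
  assert (Hre : smooth_frame U frame_re).
  { destruct (smooth_on_coordinates U); split; simpl; trivial.
    apply smooth_on_opp; trivial. }
  assert (Him : smooth_frame U frame_im).
  { destruct (smooth_on_coordinates U); split; simpl; trivial. }
  assert (Dre : forall h, 0 <= h -> forall j s, _) by
    (intros h Hh; exact (frame_Derive_n U Phi frame_re A (tau h) (nu h) h (theta h)
       HU HPhi Hre (Hin h Hh) (Hsol h Hh) (Hth h Hh)
       (fun t => Re (curve Phi theta0 (tau h) (nu h) h t))
       (fun t => f_equal Re (curve_components Phi theta0 (tau h) (nu h) h t)))).
  assert (Dim : forall h, 0 <= h -> forall j s, _) by
    (intros h Hh; exact (frame_Derive_n U Phi frame_im A (tau h) (nu h) h (theta h)
       HU HPhi Him (Hin h Hh) (Hsol h Hh) (Hth h Hh)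
       (fun t => Im (curve Phi theta0 (tau h) (nu h) h t))
       (fun t => f_equal Im (curve_components Phi theta0 (tau h) (nu h) h t)))).
  assert (Hck : forall h, 0 <= h -> curve_Ck k (curve Phi theta0 (tau h) (nu h) h)).
  { intros h Hh j s _; split; [| split].
    - destruct j as [| j]; [exact I | apply (Dre h Hh j s)].
    - destruct j as [| j]; [exact I | apply (Dim h Hh j s)].
    - apply continuous_C;
        [ apply (ex_derive_continuous (Derive_n _ j)), (Dre h Hh j s)
        | apply (ex_derive_continuous (Derive_n _ j)), (Dim h Hh j s) ]. }
  split; [exact Hck |]; split; [apply Hck, Rle_refl |].
  destruct (state_converges Phi A tau nu (HPhi 1%nat) HA Heq Hsol) as [St Sn].
  pose proof (fun G HG => observable_converges tau nu A G St Sn HG) as Sobs.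
  assert (Sth : small_on_compacts (fun h s => theta h s - theta 0 s)).
  { apply (angle_converges Phi theta0 tau nu theta A Hth); [| exact H0 |].
    - intros h; unfold theta, angle; rewrite RInt_point; apply Rplus_0_r.
    - apply (Sobs Phi), (proj1 (HPhi 0%nat)), Hp0. }
  assert (Sframe : forall F, smooth_frame U F -> forall j, small_on_compacts (fun h s =>
    frame_eval (Nat.iter j (frame_derive Phi) F) (tau h s, nu h s, h) (theta h s) -
    frame_eval (Nat.iter j (frame_derive Phi) F) (0, A, 0) (theta 0 s))).
  { intros F HF j.
    destruct (smooth_frame_iter U Phi F HU HPhi HF j) as [X1 X2].
    apply frame_eval_converges; trivial; apply Sobs.
    - apply (X1 0%nat), Hp0.
    - apply (X2 0%nat), Hp0. }
  intros K HK eps Heps.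
  destruct (compact_P1 K HK) as (a & b & Hab).
  set (S := Rmax (Rabs a) (Rabs b)).
  destruct (small_on_compacts_finite _ (Sframe _ Hre) k S (eps / 2)) as (d1 & Hd1 & B1);
    [lra |].
  destruct (small_on_compacts_finite _ (Sframe _ Him) k S (eps / 2)) as (d2 & Hd2 & B2);
    [lra |].
  assert (Hd : 0 < Rmin d1 d2) by (apply Rmin_glb_lt; trivial).
  exists (mkposreal _ Hd); intros h Hball Hh j s Hj Ks.
  change (Rabs (h - 0) < Rmin d1 d2) in Hball.
  rewrite Rminus_0_r, Rabs_pos_eq in Hball by exact Hh.
  pose proof (Rmin_l d1 d2); pose proof (Rmin_r d1 d2).
  assert (Hs : Rabs s <= S) by (apply RmaxAbs; apply Hab, Ks).
  unfold curve_derive_n.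
  rewrite (proj1 (Dre h Hh j s)), (proj1 (Dim h Hh j s)).
  rewrite (proj1 (Dre 0 (Rle_refl 0) j s)), (proj1 (Dim 0 (Rle_refl 0) j s)).
  destruct (H0 s) as [-> ->].
  specialize (B1 h s j ltac:(lra) Hs Hj); specialize (B2 h s j ltac:(lra) Hs Hj).
  eapply Rle_lt_trans; [apply Cmod_minus_le |].
  replace eps with (eps / 2 + eps / 2) by field.
  apply Rplus_lt_compat; [exact B1 | exact B2].
Qed.
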